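(* Let $G$ be a loopless multigraph on $[n]$ and let $R_G^{\mathcal{O}}$ be its reduction tree with respect to the order $\mathcal{O}$. The simplices $\mathcal{F}_{\widetilde{L}}$, for $L$ ranging over the full dimensional leaves of $R_G^{\mathcal{O}}$, induce a triangulation of $\mathcal{F}_{\widetilde{G}}$; that is, the intersection of any two of them is a face of both. Moreover, for every leaf $L$ of $R_G^{\mathcal{O}}$ (full dimensional or not), the simplex $\mathcal{F}_{\widetilde{L}}$ is part of this triangulation.
   Context: Graphs are finite loopless multigraphs on the vertex set $[n]$; each edge is written $(i,j)$ with $i<j$. Reduction: if $G$ has edges $a=(i,j)$ and $b=(j,k)$ with $i<j<k$, reducing on them produces three graphs on $[n]$: $G_1$ with $E(G_1)=E(G)\setminus\{b\}\cup\{(i,k)\}$, $G_2$ with $E(G_2)=E(G)\setminus\{a\}\cup\{(i,k)\}$, and $G_3$ with $E(G_3)=E(G)\setminus\{a,b\}\cup\{(i,k)\}$; the new edge $(i,k)$ is formally regarded as the sum $a+b$, all other edges unchanged. A reduction tree of $G$ is a rooted tree with nodes labeled by graphs, root labeled $G$, in which each non-leaf node $H$ has exactly three children obtained by a reduction on some pair of edges of $H$, drawn from left to right as $H_1$ (left), $H_3$ (middle), $H_2$ (right); its leaves are exactly the nodes whose graph has no pair of edges $(i,j),(j,k)$ with $i<j<k$. By iteration every edge of every node is a formal sum of edges of $G$ (edges of $G$, including multiple edges, being distinguished), and two edges in different nodes are equal iff they are sums of the same edges of $G$. A leaf is full dimensional if it has $|E(G)|$ edges. The order $\mathcal{O}$: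 at a node $H$ not yet a leaf, let $v$ be the smallest vertex having both an edge $(a,v)$ with $a<v$ and an edge $(v,b)$ with $b>v$; reduce on an edge $(a,v)$ with $a$ minimal and an edge $(v,b)$ with $b$ maximal. The resulting reduction tree is $R_G^{\mathcal{O}}$. Augmented graph: $\widetilde{G}$ has vertex set $[n]\cup\{s,t\}$ with $s$ smallest and $t$ largest, and edges $E(G)\cup\{(s,i),(i,t): i\in[n]\}$. The flow polytope $\mathcal{F}_{\widetilde{G}}\subset\mathbb{R}^{E(\widetilde G)}$ is the set of nonnegative edge flows with total outflow $1$ at $s$, total inflow $1$ at $t$, and flow conservation at every $i\in[n]$. For a node $H$ of $R_G^{\mathcal{O}}$, each edge $(v_1,v_2)=e_{i_1}+\cdots+e_{i_l}$ of $H$ (with $e_{i_j}\in E(G)$) determines the route $(s,v_1),e_{i_1},\ldots,e_{i_l},(v_2,t)$ in $\widetilde G$, and $\mathcal{F}_{\widetilde{H}}$ is the convex hull of the unit flows along the routes determined by the edges of $H$.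
   Formalization: Ties among parallel edges in the order O are broken by fixed (arbitrary) linear orders on formal sums, the same at all nodes; and F_{H~} is the hull of unit flows along all routes of H~, including the routes (s,i),(i,t), not only those determined by edges of H. *)

(* Defs.v *)
From HB Require Import structures.
From mathcomp Require Import all_boot all_order all_algebra.
From mathcomp Require Import boolp classical_sets functions cardinality reals.
From mathcomp Require Import convex.

Set Implicit Arguments.
Unset Strict Implicit.
Unset Printing Implicit Defensive.

Import Order.TTheory GRing.Theory Num.Theory.
Local Open Scope classical_set_scope.
Local Open Scope ring_scope.

(** ** Polytopes and triangulations *)

Definition convex_hull (R : realType) (V : lmodType R) (X : set V) : set V :=
  smallest (@convex_set R V) X.

Definition affinely_independent (R : realType) (V : lmodType R) (k : nat)
    (v : 'I_k -> V) : Prop :=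
  forall c : 'I_k -> R,
    \sum_(i < k) c i = 0 -> \sum_(i < k) c i *: v i = 0 -> forall i, c i = 0.

(* The empty set is the simplex with no vertices (k = 0). *)
Definition is_simplex (R : realType) (V : lmodType R) (S : set V) : Prop :=
  exists (k : nat) (v : 'I_k -> V),
    affinely_independent v /\ S = convex_hull (range v).

(* Faces cut out by valid linear inequalities; [c = 0] gives the two improper
   faces, [P] itself and the empty set. *)
Definition is_face (R : realType) (V : lmodType R) (F P : set V) : Prop :=
  exists (c : {scalar V}) (d : R),
    (forall x, P x -> c x <= d) /\ F = [set x | P x /\ c x = d].

Definition is_triangulation (R : realType) (V : lmodType R)
    (P : set V) (T : set (set V)) : Prop :=
  [/\ finite_set T,
      forall S, T S -> is_simplex S,
      forall S F, T S -> is_face F S -> T F,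
      forall S1 S2, T S1 -> T S2 ->
        is_face (S1 `&` S2) S1 /\ is_face (S1 `&` S2) S2
    & \bigcup_(S in T) S = P].

Definition faces_of (R : realType) (V : lmodType R) (C : set (set V)) :
    set (set V) :=
  [set F | exists2 S, C S & is_face F S].

(** ** Multigraphs and flow polytopes *)

(* A loopless multigraph on the vertex set {0, ..., n-1}: parallel edges are
   distinct elements of [edges]. *)
Record mgraph (n : nat) := MGraph {
  edges : finType;
  esrc : edges -> 'I_n;
  etgt : edges -> 'I_n;
  esrc_lt_etgt : forall e, (esrc e < etgt e)%N }.

(* Flows from the smallest vertex (source) to the largest one (sink). *)
Definition flow_polytope (R : realType) (N : nat) (K : mgraph N.+2) :
    set {ffun edges K -> R^o} :=
  [set x | [/\ forall e, 0 <= x e,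
               \sum_(e | esrc e == ord0) x e = 1,
               \sum_(e | etgt e == ord_max) x e = 1
             & forall v, v != ord0 -> v != ord_max ->
                 \sum_(e | etgt e == v) x e = \sum_(e | esrc e == v) x e]].
Arguments flow_polytope R {N} K _.

(* The vertices of the augmented graph are s = 0, then the vertices of G
   shifted by one, then t = n + 1. *)
Definition inner_vertex (n : nat) (i : 'I_n) : 'I_n.+2 :=
  lift ord0 (lift ord_max i).

(* [inl e] is an edge of G, [inr (inl i)] is (s, i), [inr (inr i)] is (i, t). *)
Definition aug_edge (n : nat) (G : mgraph n) : finType :=
  (edges G + ('I_n + 'I_n))%type.

Definition aug_src (n : nat) (G : mgraph n) (x : aug_edge G) : 'I_n.+2 :=
  match x with
  | inl e => inner_vertex (esrc e)
  | inr (inl _) => ord0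
  | inr (inr i) => inner_vertex i
  end.

Definition aug_tgt (n : nat) (G : mgraph n) (x : aug_edge G) : 'I_n.+2 :=
  match x with
  | inl e => inner_vertex (etgt e)
  | inr (inl i) => inner_vertex i
  | inr (inr _) => ord_max
  end.

Lemma inner_vertexE (n : nat) (i : 'I_n) : inner_vertex i = i.+1 :> nat.
Proof. by rewrite /= /bump [(n <= i)%N]leqNgt ltn_ord. Qed.

Lemma aug_src_lt_tgt (n : nat) (G : mgraph n) (x : aug_edge G) :
  (aug_src x < aug_tgt x)%N.
Proof.
case: x => [e|[i|i]]; rewrite /aug_src /aug_tgt ?inner_vertexE //=.
- exact: esrc_lt_etgt.
- by rewrite ltnS ltn_ord.
Qed.

Definition augment (n : nat) (G : mgraph n) : mgraph n.+2 :=
  MGraph (@aug_src_lt_tgt n G).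

(** ** Reduction trees *)

(* An edge (i, k) = e_1 + ... + e_l of a node of a reduction tree of G is the
   triple of i, k and the list e_1, ..., e_l in the order in which these edges
   follow each other from i to k; this list and the sum determine each other. *)
Definition sedge (n : nat) (G : mgraph n) : eqType :=
  ('I_n * 'I_n * seq (edges G))%type.

Definition ssrc (n : nat) (G : mgraph n) (h : sedge G) : 'I_n := h.1.1.
Definition stgt (n : nat) (G : mgraph n) (h : sedge G) : 'I_n := h.1.2.
Definition summands (n : nat) (G : mgraph n) (h : sedge G) : seq (edges G) :=
  h.2.

Definition add_sedge (n : nat) (G : mgraph n) (a b : sedge G) : sedge G :=
  (ssrc a, stgt b, summands a ++ summands b).

(* A graph labelling a node is the list of its edges. *)
Definition sgraph (n : nat) (G : mgraph n) := seq (sedge G).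

Definition initial_sgraph (n : nat) (G : mgraph n) : sgraph G :=
  [seq (esrc e, etgt e, [:: e]) | e <- enum (edges G)].

Definition reducible_pair (n : nat) (G : mgraph n) (H : sgraph G)
    (a b : sedge G) : Prop :=
  [/\ a \in H, b \in H & stgt a = ssrc b].

Definition reduce1 (n : nat) (G : mgraph n) (H : sgraph G) (a b : sedge G) :
  sgraph G := add_sedge a b :: rem b H.
Definition reduce2 (n : nat) (G : mgraph n) (H : sgraph G) (a b : sedge G) :
  sgraph G := add_sedge a b :: rem a H.
Definition reduce3 (n : nat) (G : mgraph n) (H : sgraph G) (a b : sedge G) :
  sgraph G := add_sedge a b :: rem a (rem b H).

Inductive rtree (n : nat) (G : mgraph n) : Type :=
| RLeaf of sgraph G
| RNode of sgraph G & rtree G & rtree G & rtree G.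

Definition root (n : nat) (G : mgraph n) (T : rtree G) : sgraph G :=
  match T with RLeaf H => H | RNode H _ _ _ => H end.

Fixpoint leaves (n : nat) (G : mgraph n) (T : rtree G) : seq (sgraph G) :=
  match T with
  | RLeaf H => [:: H]
  | RNode _ Tl Tm Tr => leaves Tl ++ leaves Tm ++ leaves Tr
  end.

(* [rule H a b]: the rule allows the reduction of H on the edges a, b. *)
Fixpoint reductions_follow (n : nat) (G : mgraph n)
    (rule : sgraph G -> sedge G -> sedge G -> Prop) (T : rtree G) : Prop :=
  match T with
  | RLeaf H => forall a b, ~ reducible_pair H a b
  | RNode H Tl Tm Tr =>
      (exists a b, [/\ reducible_pair H a b, rule H a b,
         root Tl = reduce1 H a b, root Tm = reduce3 H a b
       & root Tr = reduce2 H a b]) /\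
      [/\ reductions_follow rule Tl, reductions_follow rule Tm
        & reductions_follow rule Tr]
  end.

Definition is_linear_order (T : Type) (r : rel T) : Prop :=
  [/\ antisymmetric r, transitive r & total r].

(* The order O.  Parallel edges of a node are ranked by two linear orders on
   formal sums, [rin] for the edge entering the vertex v and [rout] for the edge
   leaving it, that are the same at all nodes: if parallel edges could be ranked
   differently at different nodes, the resulting simplices would in general not
   meet along faces. *)
Definition order_O (n : nat) (G : mgraph n) (rin rout : rel (sedge G))
    (H : sgraph G) (a b : sedge G) : Prop :=
  [/\ reducible_pair H a b,
      forall a' b', reducible_pair H a' b' -> (stgt a <= stgt a')%N,
      forall a', a' \in H -> stgt a' = stgt a ->
        (ssrc a < ssrc a')%N \/ (ssrc a' = ssrc a /\ rin a a')
    & forall b', b' \in H -> ssrc b' = ssrc b ->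
        (stgt b' < stgt b)%N \/ (stgt b' = stgt b /\ rout b b')].

Definition is_reduction_tree_O (n : nat) (G : mgraph n)
    (rin rout : rel (sedge G)) (T : rtree G) : Prop :=
  root T = initial_sgraph G /\ reductions_follow (order_O rin rout) T.

Definition is_leaf (n : nat) (G : mgraph n) (T : rtree G) (L : sgraph G) :
  Prop := L \in leaves T.

Definition is_full_dim_leaf (n : nat) (G : mgraph n) (T : rtree G)
    (L : sgraph G) : Prop :=
  is_leaf T L /\ size L = #|edges G|.

(** ** The polytope of a node *)

(* [walk H v w p]: consecutive edges of H lead from v to w, and p lists the
   edges of G in their sums.  The empty walk at v corresponds to the route
   (s, v), (v, t) of the augmented graph. *)
Inductive walk (n : nat) (G : mgraph n) (H : sgraph G) :
    'I_n -> 'I_n -> seq (edges G) -> Prop :=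
| walk_nil v : walk H v v [::]
| walk_rcons v p h : walk H v (ssrc h) p -> h \in H ->
    walk H v (stgt h) (p ++ summands h).

Definition route (n : nat) (G : mgraph n) (v w : 'I_n) (p : seq (edges G)) :
    seq (edges (augment G)) :=
  (inr (inl v) : aug_edge G) :: rcons [seq inl e | e <- p] (inr (inr w)).

Definition unit_flow (R : realType) (N : nat) (K : mgraph N)
    (r : seq (edges K)) : {ffun edges K -> R^o} :=
  [ffun x => (count_mem x r)%:R].

(* The flow polytope of the augmented graph of H, as a subset of the space of
   flows on the augmented graph of G: the convex hull of the unit flows along
   all routes s -> t of the augmented graph of H. *)
Definition node_polytope (R : realType) (n : nat) (G : mgraph n)
    (H : sgraph G) : set {ffun edges (augment G) -> R^o} :=
  convex_hull [set f | exists v w p, walk H v w p /\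
                         f = unit_flow R (route v w p)].
Arguments node_polytope R {n G} H _.

(** ** Sanity checks *)

(* If no pair of edges of H is reducible, the only routes are the routes
   (s, v), (v, t) and those determined by the edges of H. *)
Lemma walk_leaf (n : nat) (G : mgraph n) (H : sgraph G) v w p :
  (forall a b, ~ reducible_pair H a b) ->
  walk H v w p <-> (v = w /\ p = [::]) \/ (v, w, p) \in H.
Proof.
move=> leafH; split; last first.
  case=> [[-> ->]|vwH]; first exact: walk_nil.
  exact: (@walk_rcons _ _ H v [::] (v, w, p) (walk_nil H v) vwH).
elim=> [u|u q h _ [[-> ->]|uH] hH]; first by left.
- by right; case: h hH => [[]].
- by case: (leafH _ _ (And3 uH hH erefl)).
Qed.

Lemma seq_min (T : eqType) (r : rel T) (s : seq T) (x : T) :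
  transitive r -> total r -> x \in s ->
  exists2 y, y \in s & forall z, z \in s -> r y z.
Proof.
move=> tr tot; elim: s x => [//|u [_ x _|u' s IH x _]].
  exists u; rewrite ?mem_head // => z; rewrite inE => /eqP ->.
  by case/orP: (tot u u).
have [y yIn yP] := IH u' (mem_head _ _).
have [uy|yu] := orP (tot u y).
- exists u; first exact: mem_head.
  move=> z; rewrite inE => /predU1P [->|/yP]; last exact: tr.
  by case/orP: (tot u u).
- exists y; first by rewrite inE yIn orbT.
  by move=> z; rewrite inE => /predU1P [->|/yP].
Qed.

Lemma lex_linear (T : Type) (f : T -> nat) (r : rel T) :
  transitive r -> total r ->
  let r' := [rel x y | (f x < f y)%N || (f y == f x) && r x y] in
  transitive r' /\ total r'.
Proof.
move=> tr tot; split=> [y x z|x y] /=.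
- case/orP=> [xy|/andP [/eqP xy rxy]] /orP [yz|/andP [/eqP yz ryz]].
  + by rewrite (ltn_trans xy yz).
  + by rewrite yz xy.
  + by rewrite -xy yz.
  + by rewrite yz xy eqxx (tr _ _ _ rxy ryz) orbT.
- by case: ltngtP => //= _; exact: tot.
Qed.

Lemma order_O_exists (n : nat) (G : mgraph n) (rin rout : rel (sedge G))
    (H : sgraph G) (a0 b0 : sedge G) :
  is_linear_order rin -> is_linear_order rout -> reducible_pair H a0 b0 ->
  exists a b, order_O rin rout H a b.
Proof.
move=> [_ trin totin] [_ trout totout] [a0H b0H ab0].
pose Q := [seq h <- H | has (fun h' => stgt h == ssrc h') H].
have a0Q : a0 \in Q.
  by rewrite mem_filter a0H andbT; apply/hasP; exists b0; rewrite ?ab0.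
have [a1 + a1min] := @seq_min _ (relpre (fun h : sedge G => val (stgt h)) leq)
  Q a0 (fun y x z => @leq_trans _ _ _) (fun x y => leq_total _ _) a0Q.
rewrite mem_filter => /andP [/hasP [b1 b1H /eqP ab1] a1H].
have [trl totl] := @lex_linear _ (fun h : sedge G => val (ssrc h)) _ trin totin.
have a1I : a1 \in [seq h <- H | stgt h == stgt a1].
  by rewrite mem_filter eqxx.
have [a + amin] := seq_min trl totl a1I.
rewrite mem_filter => /andP [/eqP aa1 aH].
have trr : transitive (fun x y : sedge G => rout y x).
  by move=> y x z xy yz; exact: trout yz xy.
have [trl' totl'] := @lex_linear _ (fun h : sedge G => n - stgt h)%N _ trout
  totout.
have b1I : b1 \in [seq h <- H | ssrc h == ssrc b1].
  by rewrite mem_filter eqxx.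
have [b + bmin] := seq_min trl' totl' b1I.
rewrite mem_filter => /andP [/eqP bb1 bH].
exists a, b; split.
- by split; rewrite // aa1 ab1 bb1.
- move=> a' b' [a'H b'H ab']; rewrite aa1; apply: a1min.
  by rewrite mem_filter a'H andbT; apply/hasP; exists b'; rewrite ?ab'.
- move=> a' a'H a'a; have := amin a'.
  rewrite mem_filter a'a aa1 eqxx a'H => /(_ isT) /= /orP [->|]; first by left.
  by case/andP=> /eqP /val_inj -> ?; right.
- move=> b' b'H b'b; have := bmin b'.
  rewrite mem_filter b'b bb1 eqxx b'H => /(_ isT) /= /orP [lt|].
    by left; rewrite -(ltn_sub2lE (m:=n)) // ltnW.
  case/andP=> /eqP e ?; right; split=> //; apply: val_inj.
  by rewrite /= -[LHS](subKn (ltnW (ltn_ord _))) e subKn // ltnW.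
Qed.

Lemma reduction_tree_O_exists (n : nat) (G : mgraph n)
    (rin rout : rel (sedge G)) :
  is_linear_order rin -> is_linear_order rout ->
  exists T, is_reduction_tree_O rin rout T.
Proof.
move=> linin linout.
pose inc (h : sedge G) := (ssrc h < stgt h)%N.
pose wt (h : sedge G) := (n + ssrc h - stgt h)%N.
pose mu (H : sgraph G) := (\sum_(h <- H) wt h)%N.
suff tree N (H : sgraph G) : all inc H -> (mu H <= N)%N ->
    exists T : rtree G, root T = H /\ reductions_follow (order_O rin rout) T.
  apply: (tree _ _ _ (leqnn _)); apply/allP => h /mapP [e _ ->].
  exact: esrc_lt_etgt.
elim: N H => [|N IH] H incH muH.
all: have [red|nred] := pselect (exists a b, reducible_pair H a b);
  last by exists (RLeaf H); split=> // a b ab; apply: nred; exists a, b.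
all: move: red => [a0 [b0 red]].
all: have [a [b ab]] := order_O_exists linin linout red.
all: have [[aH bH eab] _ _ _] := ab.
all: have muE h : h \in H -> mu H = (wt h + mu (rem h H))%N
  by move=> hH; rewrite /mu (perm_big _ (perm_to_rem hH)) big_cons.
all: have inca := allP incH _ aH.
all: have incb := allP incH _ bH.
all: rewrite /inc in inca incb.
all: have lta : (wt (add_sedge a b) < wt a)%N.
1,3: rewrite /wt /ssrc /stgt /= -/(ssrc a) -/(stgt a) -/(stgt b).
1,2: rewrite ltn_sub2l //; first by rewrite (leq_trans (ltn_ord _)) ?leq_addr.
1,2: by rewrite eab.
all: have ltb : (wt (add_sedge a b) < wt b)%N.
1,3: rewrite /wt /ssrc /stgt /= -/(ssrc a) -/(ssrc b) -/(stgt b).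
1,2: rewrite ltn_sub2r //; last by rewrite ltn_add2l -eab.
1,2: by rewrite (leq_trans (ltn_ord _)) ?leq_addr.
  by move: muH; rewrite (muE _ aH) leqn0 addn_eq0 => /andP [/eqP wa _];
     rewrite wa in lta.
have incab : inc (add_sedge a b).
  by rewrite /inc /ssrc /stgt /= (ltn_trans inca) // eab.
have inc_rem h (K : sgraph G) : all inc K -> all inc (rem h K).
  by move=> /allP aK; apply/allP => k /mem_rem /aK.
have abH : a \in rem b H.
  have : a \in b :: rem b H by rewrite -(perm_mem (perm_to_rem bH)).
  by rewrite inE => /predU1P [e|//]; move: inca; rewrite e -eab e ltnn.
have muE3 : mu (rem b H) = (wt a + mu (rem a (rem b H)))%N.
  by rewrite /mu (perm_big _ (perm_to_rem abH)) big_cons.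
have [||Tl [rTl oTl]] := IH (reduce1 H a b).
- by rewrite /= incab inc_rem.
- rewrite /mu big_cons -ltnS (leq_trans _ muH) // (muE _ bH) ltn_add2r //.
have [||Tm [rTm oTm]] := IH (reduce3 H a b).
- by rewrite /= incab !inc_rem.
- rewrite /mu big_cons -ltnS (leq_trans _ muH) // (muE _ bH) -addSn.
  by rewrite leq_add // muE3 leq_addl.
have [||Tr [rTr oTr]] := IH (reduce2 H a b).
- by rewrite /= incab inc_rem.
- by rewrite /mu big_cons -ltnS (leq_trans _ muH) // (muE _ aH) ltn_add2r.
exists (RNode H Tl Tm Tr); split=> //=; split=> //.
by exists a, b.
Qed.

(* Main.v *)
(* Assign weights to the edges of a node H and push them down the tree: reducing
   on a, b with weights x_a >= x_b moves the weight x_b from a and b to a + b,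
   and the child from which b is removed carries the result.  Flows on the
   augmented graph of G are thereby carried to full dimensional leaves, which
   gives the covering.

   Conversely, a weight on any leaf lifts to a weight on the root, which is
   determined by the flow it represents.  Restricted to the edges of positive
   weight, the order O selects the same pair of edges whatever the node, so the
   lifted weight is brought back to the leaf by a greedy algorithm that does not
   refer to the tree.  Therefore every flow is a nonnegative combination of leaf
   routes in at most one way, even when the leaf is allowed to vary; this makes
   the polytopes of the leaves simplices that intersect along the convex hulls of
   their common routes. *)

Require Import Defs.
From HB Require Import structures.
From mathcomp Require Import all_boot all_order all_algebra.
From mathcomp Require Import boolp classical_sets functions cardinality reals.
From mathcomp Require Import interval_inference convex.
From mathcomp Require Import ring lra.

Import Order.TTheory GRing.Theory Num.Theory.
Local Open Scope classical_set_scope.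
Local Open Scope ring_scope.

Set Implicit Arguments.
Unset Strict Implicit.
Unset Printing Implicit Defensive.

(** Weights are functions on the whole index type that vanish off a list, so that weights on
    different lists can be compared as functions. *)
Definition supported (I : eqType) (R : realType) (y : I -> R) (K : seq I) :=
  forall h, h \notin K -> y h = 0.

Definition weights (I : eqType) (R : realType) (y : I -> R) (K : seq I) :=
  (forall h, 0 <= y h) /\ supported y K.

(** * Convex hulls of families with unique weights *)

Section Sums.
Variables (R : realType) (I : eqType).
Implicit Types (y : I -> R) (K : seq I).

Lemma supportedW y K K' : supported y K -> {subset K <= K'} -> supported y K'.
Proof. by move=> sy sK h hK'; apply: sy; apply: contra hK' => /sK. Qed.

Lemma supportedI y K K' : supported y K -> supported y K' ->
  supported y [seq h <- K | h \in K'].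
Proof.
by move=> s1 s2 h; rewrite mem_filter negb_and => /orP [/s2|/s1].
Qed.

Lemma sum_supported (V : lmodType R) (v : I -> V) y K K' :
    uniq K -> uniq K' -> supported y K -> {subset K <= K'} ->
  \sum_(h <- K') y h *: v h = \sum_(h <- K) y h *: v h.
Proof.
move=> uK uK' sy sK.
have pK : perm_eq K [seq h <- K' | h \in K].
  apply: uniq_perm; rewrite ?filter_uniq // => h; rewrite mem_filter.
  by apply/idP/andP => [hK|[]//]; split=> //; apply: sK.
rewrite (perm_big _ pK) big_filter [RHS]big_mkcond; apply: eq_bigr => h _.
by case: ifP => // /negbT /sy ->; rewrite scale0r.
Qed.

Lemma sum_supported1 y K K' :
    uniq K -> uniq K' -> supported y K -> {subset K <= K'} ->
  \sum_(h <- K') y h = \sum_(h <- K) y h.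
Proof.
move=> uK uK' sy sK; have := sum_supported (fun=> 1 : R^o) uK uK' sy sK.
have E L : \sum_(h <- L) y h *: (1 : R^o) = \sum_(h <- L) y h.
  by apply: eq_bigr => h _; rewrite /GRing.scale /= mulr1.
by rewrite !E.
Qed.

End Sums.

Section Hull.
Variables (R : realType) (I : eqType) (V : vectType R) (u : I -> V).
Implicit Types (y c : I -> R) (K : seq I).

Definition hull K : set V := convex_hull [set u h | h in [set h | h \in K]].

Lemma convex_setD (A : set V) (a b : V) (t : R) : @convex_set R V A ->
  0 <= t -> t <= 1 -> A a -> A b -> A (t *: a + (1 - t) *: b).
Proof.
move=> cA t0 t1 Aa Ab.
by have := cA a b (Itv01 t0 t1) (mem_set Aa) (mem_set Ab); rewrite inE.
Qed.

Lemma convex_setI (A : set V) :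
    (forall (a b : V) (t : R), 0 <= t -> t <= 1 -> A a -> A b ->
       A (t *: a + (1 - t) *: b)) -> @convex_set R V A.
Proof.
by move=> H a b t; rewrite !inE => Aa Ab; apply: H; rewrite ?ge0 ?le1.
Qed.

Lemma convex_comb (A : set V) K y :
    @convex_set R V A -> (forall h, h \in K -> A (u h)) ->
    (forall h, 0 <= y h) -> \sum_(h <- K) y h = 1 ->
  A (\sum_(h <- K) y h *: u h).
Proof.
move=> cA; elim: K y => [|h K IH] y AK y0.
  by rewrite big_nil => /eqP; rewrite eq_sym oner_eq0.
rewrite !big_cons => y1.
have sK : \sum_(i <- K) y i = 1 - y h by rewrite -y1 addrC addKr.
have yh1 : y h <= 1 by rewrite -subr_ge0 -sK sumr_ge0.
(* The tail is normalised by [1 - y h]; when this is zero, all weights of the tail vanish. *)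
have [e|ne] := eqVneq (y h) 1.
  have z : forall i, i \in K -> y i = 0.
    move=> i iK; apply/eqP; rewrite eq_le y0 andbT.
    have : \sum_(i <- K) y i = 0 by rewrite sK e subrr.
    by rewrite (big_rem i) //= => <-; rewrite lerDl sumr_ge0.
  rewrite big_seq big1 ?addr0 ?e ?scale1r => [|i iK]; last by rewrite z ?scale0r.
  by apply: AK; rewrite mem_head.
have s0 : 1 - y h != 0 by rewrite subr_eq0 eq_sym.
have AK' : A (\sum_(i <- K) ((1 - y h)^-1 * y i) *: u i).
  apply: IH => [i iK|i|]; first by apply: AK; rewrite inE iK orbT.
    by rewrite mulr_ge0 // invr_ge0 subr_ge0.
  by rewrite -mulr_sumr sK mulVf.
have -> : \sum_(i <- K) y i *: u i =
          (1 - y h) *: \sum_(i <- K) ((1 - y h)^-1 * y i) *: u i.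
  rewrite scaler_sumr; apply: eq_bigr => i _.
  by rewrite scalerA mulrA mulfV // mul1r.
exact: convex_setD (AK _ (mem_head _ _)) AK'.
Qed.

Lemma hullP K f : uniq K -> hull K f <->
  exists y, [/\ weights y K, \sum_(h <- K) y h = 1
              & f = \sum_(h <- K) y h *: u h].
Proof.
move=> uK; split=> [|[y [[y0 _] y1 ->]]]; last first.
  move=> A [cA sA]; apply: convex_comb => // h hK; apply: sA; by exists h.
pose A := [set f | exists y, [/\ weights y K, \sum_(h <- K) y h = 1
                             & f = \sum_(h <- K) y h *: u h]].
apply: (@smallest_sub _ _ _ A).
- apply: convex_setI => _ _ t t0 t1 [y [[y0 sy] y1 ->]] [z [[z0 sz] z1 ->]].
  exists (fun h => t * y h + (1 - t) * z h); split.
  + split=> [h|h hK]; last by rewrite sy ?sz // !mulr0 addr0.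
    by rewrite addr_ge0 // mulr_ge0 // subr_ge0.
  + by rewrite big_split /= -!mulr_sumr y1 z1 !mulr1 addrC subrK.
  + rewrite !scaler_sumr -big_split /=.
    by apply: eq_bigr => h _; rewrite [RHS]scalerDl !scalerA.
- move=> _ [h hK <-]; exists (fun i => (i == h)%:R); split.
  + by split=> [i|i iK]; [exact: ler0n|case: eqP iK => // ->; rewrite hK].
  + by rewrite (bigD1_seq h) //= eqxx big1 ?addr0 // => i /negPf ->.
  + rewrite (bigD1_seq h) //= eqxx big1 ?addr0 ?scale1r // => i /negPf ->.
    by rewrite scale0r.
Qed.

Lemma hull_sub K K' : {subset K <= K'} -> hull K `<=` hull K'.
Proof.
move=> sK; apply: sub_smallest2r; last by move=> _ [h /sK hK <-]; exists h.
apply: convex_setI => a b t t0 t1 Ha Hb A HA; have [cA _] := HA.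
exact: convex_setD (Ha A HA) (Hb A HA).
Qed.

(** Linear independence, stronger than the affine independence of [is_simplex]: it yields
    functionals with prescribed values on the [u h]. *)
Definition free_family K :=
  forall c, supported c K -> \sum_(h <- K) c h *: u h = 0 -> forall h, c h = 0.

Lemma free_family_sub K K' : uniq K -> uniq K' -> {subset K <= K'} ->
  free_family K' -> free_family K.
Proof.
move=> uK uK' sK fK' c sc c0; apply: fK'; first exact: supportedW sK.
by rewrite (sum_supported _ uK uK').
Qed.

Lemma free_family_nth K (i0 : I) (c : 'I_(size K) -> R) :
    uniq K -> free_family K ->
  \sum_(i < size K) c i *: u (nth i0 K i) = 0 -> forall i, c i = 0.
Proof.
move=> uK fK c0 i.
(* [index h K] is [size K] when [h] is not in [K], so [insub] fails there and [d] vanishes off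
   [K]. *)
pose d h := if insub (index h K) is Some j then c j else 0.
have dE (j : 'I_(size K)) : d (nth i0 K j) = c j.
  by rewrite /d index_uniq // valK.
rewrite -dE; apply: fK => [h hK|].
  by rewrite /d insubN // -leqNgt memNindex.
rewrite (big_nth i0) big_mkord -[RHS]c0.
by apply: eq_bigr => j _; rewrite dE.
Qed.

(** The coordinate functionals of the free tuple [X] are combined with coefficients [d]. *)
Lemma dual_functional K (d : I -> R) : uniq K -> free_family K ->
  exists c : {scalar V}, forall h, h \in K -> c (u h) = d h.
Proof.
move=> uK fK.
case: (altP (@eqP _ K [::])) => [->|]; first by exists \0.
case e : K => [//|i0 K'] _; rewrite -e.
pose X : (size K).-tuple V := [tuple of map u (in_tuple K)].
have XE (i : 'I_(size K)) : X`_i = u (nth i0 K i) by rewrite (nth_map i0).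
have freeX : free X.
  apply/freeP => c c0; apply: (@free_family_nth _ i0) => //.
  by rewrite -[RHS]c0; apply: eq_bigr => i _; rewrite XE.
pose c : 'Hom(V, R^o) :=
  \sum_(i < size K) d (nth i0 K i) *: linfun (coord X i : {linear V -> R^o}).
exists (fun_of_lfun c : {linear V -> R^o}) => h hK.
have [o oE] : exists o : 'I_(size K), nth i0 K o = h.
  by exists (Ordinal (etrans (index_mem h K) hK)); rewrite nth_index.
rewrite -oE -XE /= sum_lfunE (bigD1 o) //= scale_lfunE lfunE /=.
rewrite coord_free // eqxx big1 ?addr0 => [|j jo].
  by rewrite /GRing.scale /= mulr1.
by rewrite scale_lfunE lfunE /= coord_free // eq_sym (negPf jo) scaler0.
Qed.

Lemma hull_simplex K : uniq K -> free_family K -> is_simplex (hull K).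
Proof.
move=> uK fK.
exists (size K), (fun i => u (tnth (in_tuple K) i)); split.
- move=> c _ c0 i.
  have i0 : I := tnth (in_tuple K) i.
  apply: (@free_family_nth _ i0) => //.
  by rewrite -[RHS]c0; apply: eq_bigr => j _; rewrite (tnth_nth i0).
- congr convex_hull; apply/seteqP; split=> w [].
  + move=> h hK <-; have hi : (index h K < size K)%N by rewrite index_mem.
    by exists (Ordinal hi) => //; rewrite (tnth_nth h) /= nth_index.
  + by move=> i _ <-; exists (tnth (in_tuple K) i) => //; exact: mem_tnth.
Qed.

(** * Faces of hulls *)

Lemma face_sub (W : lmodType R) (F S : set W) : is_face F S -> F `<=` S.
Proof. by move=> [c [d [_ ->]]] x []. Qed.

Lemma face_refl (W : lmodType R) (S : set W) : is_face S S.
Proof.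
exists \0, 0; split=> [x _ //=|]; apply/seteqP; split=> x //=.
by case.
Qed.

(** A point of the hull where [c] reaches the bound [d] puts no weight on a vertex where [c] is
    smaller than [d]. Hence a face is spanned by the vertices that it contains. *)
Lemma face_hull K F : uniq K -> is_face F (hull K) ->
  exists P : pred I, F = hull [seq h <- K | P h].
Proof.
move=> uK [c [d [cd ->]]].
pose P := [pred h | c (u h) == d]; exists P.
have uP : uniq [seq h <- K | P h] by rewrite filter_uniq.
have ch h : h \in K -> c (u h) <= d.
  by move=> hK; apply: cd; apply: sub_gen_smallest; exists h.
have cS (L : seq I) y : c (\sum_(h <- L) y h *: u h) = \sum_(h <- L) y h * c (u h).
  by rewrite linear_sum; apply: eq_bigr => h _; rewrite linearZ.
apply/seteqP; split=> x /=.
- case=> /(hullP _ uK) [y [[y0 sy] y1 ->]] cx; apply/hullP => //.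
  have sP : supported y [seq h <- K | P h].
    move=> h; rewrite mem_filter negb_and; case: (boolP (h \in K)) => [hK|/sy //].
    rewrite orbF /= => nP; apply/eqP; rewrite eq_le y0 andbT.
    have lt : 0 < d - c (u h) by rewrite subr_gt0 lt_neqAle nP ch.
    rewrite -(pmulr_rle0 _ lt).
    have : \sum_(h <- K) (d - c (u h)) * y h = 0.
      under eq_bigr do rewrite mulrBl [X in _ - X]mulrC.
      by rewrite sumrB -mulr_sumr y1 -cS cx mulr1 subrr.
    rewrite (big_rem h) //= => <-; rewrite lerDl big_seq sumr_ge0 // => i iK.
    by rewrite mulr_ge0 // subr_ge0 ch // (mem_rem iK).
  exists y; split=> //.
    by rewrite -(sum_supported1 uP uK) //; apply/mem_subseq/filter_subseq.
  by rewrite (sum_supported _ uP uK) //; apply/mem_subseq/filter_subseq.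
- move=> xP; split; first exact: (hull_sub (mem_subseq (filter_subseq _ _)) xP).
  move: xP => /(hullP _ uP) [y [_ y1 ->]]; rewrite cS -[RHS]mulr1 -y1 mulr_sumr.
  rewrite big_seq [RHS]big_seq; apply: eq_bigr => h.
  by rewrite mem_filter => /andP [/eqP -> _]; rewrite mulrC.
Qed.

(** By freeness some functional is 0 on the vertices selected by [P] and -1 on the others. It is
    bounded by 0 on the hull, with equality exactly on the hull of the selection. *)
Lemma hull_face K (P : pred I) : uniq K -> free_family K ->
  is_face (hull [seq h <- K | P h]) (hull K).
Proof.
move=> uK fK.
have [c cE] := dual_functional (fun h => - (~~ P h)%:R) uK fK.
have uP : uniq [seq h <- K | P h] by rewrite filter_uniq.
have cS y : c (\sum_(h <- K) y h *: u h) = - \sum_(h <- K) y h * (~~ P h)%:R.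
  rewrite linear_sum -sumrN big_seq [RHS]big_seq; apply: eq_bigr => h hK.
  by rewrite linearZ /= cE // mulrN.
exists c, 0; split=> [x /(hullP _ uK) [y [[y0 _] _ ->]]|].
  by rewrite cS oppr_le0 sumr_ge0 // => h _; rewrite mulr_ge0.
apply/seteqP; split=> x.
- move=> xP; have xK := hull_sub (mem_subseq (filter_subseq _ _)) xP; split=> //.
  move: xP => /(hullP _ uP) [y [_ _ ->]]; rewrite linear_sum big_seq big1 // => h.
  rewrite mem_filter => /andP [Ph hK].
  by rewrite linearZ /= cE // Ph oppr0 mulr0.
- case=> /(hullP _ uK) [y [[y0 sy] y1 ->]] /eqP; rewrite cS oppr_eq0 => /eqP c0.
  have sP : supported y [seq h <- K | P h].
    move=> h; rewrite mem_filter negb_and; case: (boolP (h \in K)) => [hK|/sy //].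
    rewrite orbF /= => nP; apply/eqP; rewrite eq_le y0 andbT -c0.
    rewrite (big_rem h) //= nP mulr1 lerDl sumr_ge0 // => i _.
    by rewrite mulr_ge0.
  apply/hullP => //; exists y; split=> //.
    by rewrite -(sum_supported1 uP uK) //; apply/mem_subseq/filter_subseq.
  by rewrite (sum_supported _ uP uK) //; apply/mem_subseq/filter_subseq.
Qed.

(** Equal lists [K1] and [K2] give the independence of the vertices of one cell, different lists the
    compatibility of two cells. *)
Definition unique_weights (A : set (seq I)) :=
  forall K1 K2 y1 y2, A K1 -> A K2 -> weights y1 K1 -> weights y2 K2 ->
    \sum_(h <- K1) y1 h *: u h = \sum_(h <- K2) y2 h *: u h -> y1 =1 y2.

(** The positive and negative parts of a linear relation are two nonnegative weights on [K] with the
    same combination. *)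
Lemma unique_weights_free (A : set (seq I)) K :
  unique_weights A -> A K -> free_family K.
Proof.
move=> uA AK c sc c0 h.
pose p h := Num.max (c h) 0; pose m h := Num.max (- c h) 0.
have pm i : p i - m i = c i.
  by rewrite /p /m -[0 in X in _ - X]oppr0 -oppr_min opprK addr_max_min addr0.
have wp : weights p K.
  by split=> [i|i /sc ci]; rewrite /p ?le_max ?lexx ?orbT // ci maxxx.
have wm : weights m K.
  by split=> [i|i /sc ci]; rewrite /m ?le_max ?lexx ?orbT // ci oppr0 maxxx.
rewrite -pm (uA K K p m) ?subrr //.
apply/eqP; rewrite -subr_eq0 -sumrB -[X in _ == X]c0; apply/eqP.
by apply: eq_bigr => i _; rewrite -scalerBl pm.
Qed.

(** The two weights of a common point coincide by uniqueness, so they vanish off both [J1] and [J2].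
    The sublists stand for faces of the cells [K1] and [K2]. *)
Lemma hullI (A : set (seq I)) K1 K2 J1 J2 :
    unique_weights A -> A K1 -> A K2 -> uniq K1 -> uniq K2 -> uniq J1 -> uniq J2 ->
    {subset J1 <= K1} -> {subset J2 <= K2} ->
  hull J1 `&` hull J2 = hull [seq h <- J1 | h \in J2].
Proof.
move=> uA AK1 AK2 uK1 uK2 uJ1 uJ2 s1 s2; apply/seteqP; split=> f; last first.
  by move=> Hf; split; apply: hull_sub Hf => h; rewrite mem_filter => /andP [].
case=> /(hullP _ uJ1) [y1 [[y10 sy1] y11 fE1]].
case/(hullP _ uJ2) => y2 [[y20 sy2] _ fE2].
have e : y1 =1 y2.
  apply: (uA K1 K2) => //.
  - by split=> //; apply: supportedW s1.
  - by split=> //; apply: supportedW s2.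
  - by rewrite (sum_supported _ uJ1 uK1) // (sum_supported _ uJ2 uK2) // -fE1.
have sy : supported y1 [seq h <- J1 | h \in J2].
  by apply: supportedI => // h /sy2; rewrite e.
have sub : {subset [seq h <- J1 | h \in J2] <= J1}.
  exact/mem_subseq/filter_subseq.
apply/hullP; first exact: filter_uniq.
exists y1; split=> //.
- by rewrite -(sum_supported1 _ uJ1) // filter_uniq.
- by rewrite -(sum_supported _ _ uJ1) // filter_uniq.
Qed.

Lemma triangulation_of_unique_weights (P : set V) (A : seq (seq I)) :
    (forall K, K \in A -> uniq K) -> unique_weights [set K | K \in A] ->
    \bigcup_(K in [set K | K \in A]) hull K = P ->
  is_triangulation P (faces_of [set hull K | K in [set K | K \in A]]).
Proof.
move=> unA uwA coverP.
have frA K : K \in A -> free_family K.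
  by move=> KA; apply: unique_weights_free uwA KA.
set C := faces_of _.
(* Since the lists are free, faces correspond to selections of vertices, and the conditions below
   are checked on selections. *)
have CP F : C F <-> exists K Q, K \in A /\ F = hull [seq h <- K | Q h].
  split=> [[_ [K KA <-]] /(face_hull (unA _ KA)) [Q ->]|[K [Q [KA ->]]]].
    by exists K, Q.
  by exists (hull K); [exists K|apply: hull_face; [exact: unA|exact: frA]].
have subF K (Q : pred I) : {subset [seq h <- K | Q h] <= K}.
  exact/mem_subseq/filter_subseq.
have unF K (Q : pred I) : K \in A -> uniq [seq h <- K | Q h].
  by move=> /unA; apply: filter_uniq.
have frF K (Q : pred I) : K \in A -> free_family [seq h <- K | Q h].
  move=> KA; apply: (free_family_sub (unF _ _ KA) (unA _ KA)) => //; exact: frA.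
split.
(* Selections are given by bit masks, of which each list has finitely many. *)
- apply: (@sub_finite_set _ _ (\bigcup_(K in [set K | K \in A])
      [set hull (mask (m : (size K).-tuple bool) K) | m in setT])).
    move=> F /CP [K [Q [KA ->]]]; exists K => //.
    by exists [tuple of map Q (in_tuple K)] => //=; rewrite filter_mask.
  apply: bigcup_finite; first exact: finite_seq.
  by move=> K _; apply: finite_image; exact: finite_finset.
- by move=> S /CP [K [Q [KA ->]]]; apply: hull_simplex; [exact: unF|exact: frF].
- move=> S F /CP [K [Q [KA ->]]] /(face_hull (unF _ _ KA)) [Q' ->].
  by apply/CP; exists K, (predI Q' Q); rewrite filter_predI.
- move=> S1 S2 /CP [K1 [Q1 [KA1 ->]]] /CP [K2 [Q2 [KA2 ->]]].
  have H K K' Q Q' : K \in A -> K' \in A ->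
      is_face (hull [seq h <- K | Q h] `&` hull [seq h <- K' | Q' h])
              (hull [seq h <- K | Q h]).
    move=> KA KA'; rewrite (hullI uwA KA KA' (unA _ KA) (unA _ KA')
      (unF _ Q KA) (unF _ Q' KA') (subF _ _) (subF _ _)).
    by apply: hull_face; [exact: unF|exact: frF].
  by split; [exact: H|rewrite setIC; exact: H].
- apply/seteqP; split=> f.
    case=> S [_ [K KA <-]] FS Sf; rewrite -coverP; exists K => //.
    exact: (face_sub FS).
  rewrite -coverP => -[K KA Kf]; exists (hull K) => //.
  by exists (hull K); [exists K|exact: face_refl].
Qed.

End Hull.

(** * Weights on the nodes of a reduction tree *)

Section Reduction.
Variables (R : realType) (n : nat) (G : mgraph n).
Implicit Types (H K L S : sgraph G) (a b h : sedge G) (x y : sedge G -> R).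

Lemma sum_supportedM (v : sedge G -> R) y K K' :
    uniq K -> uniq K' -> supported y K -> {subset K <= K'} ->
  \sum_(h <- K') y h * v h = \sum_(h <- K) y h * v h.
Proof. exact: (@sum_supported R _ R^o v). Qed.

Lemma sum_delta (v : sedge G -> R) (m : R) a K : uniq K -> a \in K ->
  \sum_(h <- K) m * (h == a)%:R * v h = m * v a.
Proof.
move=> uK aK; rewrite (bigD1_seq a) //= eqxx mulr1 big1 ?addr0 // => h /negPf ->.
by rewrite mulr0 mul0r.
Qed.

Definition multiplicity (e : edges G) h : R := (count_mem e (summands h))%:R.

Lemma multiplicity_add e a b :
  multiplicity e (add_sedge a b) = multiplicity e a + multiplicity e b.
Proof. by rewrite /multiplicity count_cat natrD. Qed.

(** For such [v] the sum of [x h * v h] is preserved when weights are carried along a reduction. It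
    is applied to [multiplicity], a coordinate of the flow, and to [net]. *)
Definition additive_on_paths (v : sedge G -> R) :=
  forall a b, stgt a = ssrc b -> v (add_sedge a b) = v a + v b.

Lemma multiplicity_additive e : additive_on_paths (multiplicity e).
Proof. by move=> a b _; exact: multiplicity_add. Qed.

(** The coefficient of the vertex [i] in the boundary of a path along [h]. *)
Definition net (i : 'I_n) h : R := (stgt h == i)%:R - (ssrc h == i)%:R.

Lemma net_additive i : additive_on_paths (net i).
Proof.
move=> a b ab; rewrite /net [stgt _]/(stgt b) [ssrc _]/(ssrc a) ab; ring.
Qed.

(** The summands are only required to have the boundary of a path from [ssrc h] to [stgt h]; this is
    what flow conservation uses. *)
Definition is_path h := forall i,
  \sum_e multiplicity e h * ((etgt e == i)%:R - (esrc e == i)%:R) = net i h.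

(* Linear independence of the vectors of multiplicities also shows that a
   reduction never creates an edge that is already present. *)
Record good_node H : Prop := GoodNode {
  good_uniq : uniq H;
  good_lt : forall h, h \in H -> (ssrc h < stgt h)%N;
  good_path : forall h, h \in H -> is_path h;
  good_free : forall x, supported x H ->
    (forall e, \sum_(h <- H) x h * multiplicity e h = 0) -> forall h, x h = 0 }.

(** Lifts weights from any of the three children to the parent: a unit on [a + b] becomes a unit on
    [a] and a unit on [b], which represents the same flow inside [G]. *)
Definition unpush a b x h : R :=
  x h + x (add_sedge a b) * (h == a)%:R + x (add_sedge a b) * (h == b)%:R
  - x (add_sedge a b) * (h == add_sedge a b)%:R.

(** Carries weights from the parent to a child. The minimum is the largest amount that keeps the
    weights of [a] and [b] nonnegative, and it empties one of them. *)
Definition push a b x h : R :=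
  x h - Num.min (x a) (x b) * (h == a)%:R - Num.min (x a) (x b) * (h == b)%:R
  + Num.min (x a) (x b) * (h == add_sedge a b)%:R.

(** * A single reduction step *)

Section Pair.
Variables (H : sgraph G) (a b : sedge G).
Hypotheses (gH : good_node H) (redab : reducible_pair H a b).
Let ab := add_sedge a b.

Lemma add_sedge_neq : [/\ (a == b) = false, (ab == a) = false & (ab == b) = false].
Proof.
have [aH bH e] := redab; have la := good_lt gH aH; have lb := good_lt gH bH.
split; apply/eqP.
- by move=> ba; rewrite e ba ltnn in la.
- by move=> /(congr1 (@stgt _ _)) eab; rewrite -e -eab ltnn in lb.
- by move=> /(congr1 (@ssrc _ _)) eab; rewrite e -eab ltnn in la.
Qed.

(** If [a + b] were an edge of [H], the coefficients 1, 1, -1 on [a], [b], [a + b] would be a linear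
    relation between multiplicity vectors. *)
Lemma add_sedge_notin : ab \notin H.
Proof.
have [nab na nb] := add_sedge_neq; have [aH bH e] := redab.
apply/negP => abH.
pose x h : R := 1 * (h == a)%:R + 1 * (h == b)%:R + (- 1) * (h == ab)%:R.
suff : x a = 0.
  by rewrite /x eqxx nab eq_sym na !mulr0 !addr0 mul1r => /eqP; rewrite oner_eq0.
apply: (good_free gH) => [h hH|e'].
  have F c : c \in H -> (h == c) = false.
    by move=> cH; apply: contraNF hH => /eqP ->.
  by rewrite /x (F a aH) (F b bH) (F ab abH) !mulr0 !addr0.
under eq_bigr do rewrite !mulrDl.
rewrite !big_split /= !sum_delta ?(good_uniq gH) // multiplicity_add; ring.
Qed.

Lemma unpush_supported H'' x : {subset H'' <= H} -> supported x (ab :: H'') ->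
  supported (unpush a b x) H.
Proof.
move=> sH sx h hH; have [aH bH _] := redab.
have F c : c \in H -> (h == c) = false.
  by move=> cH; apply: contraNF hH => /eqP ->.
rewrite /unpush -/ab (F a aH) (F b bH) !mulr0 !addr0.
case: eqP => [->|/eqP hab]; first by rewrite mulr1 subrr.
by rewrite mulr0 subr0; apply: sx; rewrite inE negb_or hab; apply: contra hH => /sH.
Qed.

(** Both sums are extended by zero to [ab :: H], where they differ by [x ab * (v a + v b - v ab)],
    which is zero. *)
Lemma unpush_sum (v : sedge G -> R) H'' x :
    v ab = v a + v b -> uniq H'' -> {subset H'' <= H} ->
    supported x (ab :: H'') ->
  \sum_(h <- H) unpush a b x h * v h = \sum_(h <- ab :: H'') x h * v h.
Proof.
move=> vab uH'' sH sx; have [aH bH _] := redab.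
have uK : uniq (ab :: H) by rewrite /= add_sedge_notin (good_uniq gH).
have uK'' : uniq (ab :: H'').
  by rewrite /= uH'' andbT; apply: contra add_sedge_notin => /sH.
have sub : {subset ab :: H'' <= ab :: H}.
  by move=> h; rewrite !inE => /orP [->//|/sH ->]; rewrite orbT.
rewrite -(sum_supportedM v (good_uniq gH) uK (unpush_supported sH sx)); last first.
  by move=> h hH; rewrite inE hH orbT.
rewrite -(sum_supportedM v uK'' uK sx sub).
have -> : \sum_(h <- ab :: H) unpush a b x h * v h =
    \sum_(h <- ab :: H) (x h * v h + x ab * (h == a)%:R * v h
      + x ab * (h == b)%:R * v h + (- x ab) * (h == ab)%:R * v h).
  by apply: eq_bigr => h _; rewrite /unpush -/ab; ring.
by rewrite !big_split /= !sum_delta ?inE ?eqxx ?aH ?bH ?orbT // vab; ring.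
Qed.

(** [H''] stands for the surviving edges of [H] in any of the three children. *)
Lemma reduction_good H'' : uniq H'' -> {subset H'' <= H} ->
  a \notin H'' \/ b \notin H'' -> good_node (ab :: H'').
Proof.
move=> uH'' sH nH; have [nab na nb] := add_sedge_neq; have [aH bH e] := redab.
have naH : ab \notin H'' by apply: contra add_sedge_notin => /sH.
split.
- by rewrite /= naH.
- move=> h; rewrite inE => /predU1P [->|/sH]; last exact: good_lt.
  rewrite [ssrc _]/(ssrc a) [stgt _]/(stgt b) (ltn_trans (good_lt gH aH)) //.
  by rewrite e (good_lt gH bH).
- move=> h; rewrite inE => /predU1P [-> i|/sH]; last exact: good_path.
  rewrite net_additive // -(good_path gH aH) -(good_path gH bH) -big_split /=.
  by apply: eq_bigr => e' _; rewrite multiplicity_add mulrDl.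
(* A linear relation on the child lifts by [unpush] to one on [H], which is trivial. *)
- move=> x sx x0.
  have u0 : forall h, unpush a b x h = 0.
    apply: (good_free gH); first exact: unpush_supported sx.
    move=> e'; rewrite -[RHS](x0 e'); apply: unpush_sum => //; exact: multiplicity_add.
  (* At the removed edge the lifted weight is [x ab]. *)
  have m0 : x ab = 0.
    case: nH => [aH''|bH''].
      have := u0 a; rewrite /unpush -/ab eqxx nab eq_sym na sx; last first.
        by rewrite inE eq_sym na.
      by rewrite !mulr0 mulr1 add0r addr0 subr0.
    have := u0 b; rewrite /unpush -/ab eqxx eq_sym nab eq_sym nb sx; last first.
      by rewrite inE eq_sym nb.
    by rewrite !mulr0 mulr1 !add0r subr0.
  by move=> h; rewrite -(u0 h) /unpush -/ab m0 !mul0r !addr0 subr0.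
Qed.

Lemma unpush_ge0 x : (forall h, 0 <= x h) -> forall h, 0 <= unpush a b x h.
Proof.
move=> x0 h; have [_ na nb] := add_sedge_neq; rewrite /unpush -/ab.
case: (eqVneq h ab) => [->|_].
  by rewrite na nb !mulr0 !addr0 mulr1 subrr.
by rewrite mulr0 subr0 !addr_ge0 // mulr_ge0.
Qed.

(** The lifted weights at [a] and [b] are [x a + x ab] and [x b + x ab]. As [x a] or [x b] is zero,
    their minimum is [x ab], the amount that [unpush] has moved. *)
Lemma pushK x : (forall h, 0 <= x h) -> x a = 0 \/ x b = 0 ->
  push a b (unpush a b x) = x.
Proof.
move=> x0 xab; have [nab na nb] := add_sedge_neq.
have ua : unpush a b x a = x a + x ab.
  by rewrite /unpush -/ab eqxx nab eq_sym na !mulr0 mulr1 addr0 subr0.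
have ub : unpush a b x b = x b + x ab.
  by rewrite /unpush -/ab eqxx eq_sym nab eq_sym nb !mulr0 mulr1 addr0 subr0.
have m : Num.min (unpush a b x a) (unpush a b x b) = x ab.
  rewrite ua ub; case: xab => ->; rewrite add0r.
    by apply/min_idPl; rewrite lerDr.
  by apply/min_idPr; rewrite lerDr.
by apply/funext => h; rewrite /push m /unpush -/ab; ring.
Qed.

Lemma unpushK x : supported x H -> unpush a b (push a b x) = x.
Proof.
move=> sx; have [nab na nb] := add_sedge_neq.
have p : push a b x ab = Num.min (x a) (x b).
  by rewrite /push -/ab eqxx na nb (sx _ add_sedge_notin) !mulr0 !subr0 add0r mulr1.
by apply/funext => h; rewrite /unpush -/ab p /push -/ab; ring.
Qed.

End Pair.

Lemma reduce1_good H a b : good_node H -> reducible_pair H a b ->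
  good_node (reduce1 H a b).
Proof.
move=> gH redab; have uH := good_uniq gH.
apply: (reduction_good gH redab); first exact: rem_uniq.
  by move=> h; exact: mem_rem.
by right; rewrite mem_rem_uniq // inE eqxx.
Qed.

Lemma reduce2_good H a b : good_node H -> reducible_pair H a b ->
  good_node (reduce2 H a b).
Proof.
move=> gH redab; have uH := good_uniq gH.
apply: (reduction_good gH redab); first exact: rem_uniq.
  by move=> h; exact: mem_rem.
by left; rewrite mem_rem_uniq // inE eqxx.
Qed.

Lemma reduce3_good H a b : good_node H -> reducible_pair H a b ->
  good_node (reduce3 H a b).
Proof.
move=> gH redab; have uH := good_uniq gH.
apply: (reduction_good gH redab); first by rewrite !rem_uniq.
  by move=> h /mem_rem /mem_rem.
by left; rewrite mem_rem_uniq ?rem_uniq // inE eqxx.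
Qed.

(** * The order as a rule on sets of edges *)

Variables rin rout : rel (sedge G).
Hypotheses (linin : is_linear_order rin) (linout : is_linear_order rout).

(** Endpoints are compared first, and antisymmetry of [rin] and [rout] decides between parallel
    edges; multiplicity and position in the list do not matter. *)
Lemma order_O_unique S S' a b a' b' : S =i S' ->
  order_O rin rout S a b -> order_O rin rout S' a' b' -> a = a' /\ b = b'.
Proof.
have [antin _ _] := linin; have [antout _ _] := linout.
move=> SS' [[aS bS e] minv mina minb] [[a'S b'S e'] minv' mina' minb'].
have st : stgt a = stgt a'.
  apply: val_inj; apply/eqP; rewrite eqn_leq (minv a' b') ?(minv' a b) //.
    by split; rewrite -?SS'.
  by split; rewrite ?SS'.
split.
- have [] := mina a' _ (esym st); first by rewrite SS'.
    have [||lt' lt|[-> _]] := mina' a; rewrite -?SS' ?ltnn //.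
    by have := ltn_trans lt lt'; rewrite ltnn.
  case=> s r; have [||lt|[_ r']] := mina' a; rewrite -?SS' //.
    by rewrite s ltnn in lt.
  by apply: antin; rewrite r r'.
- have sb : ssrc b = ssrc b' by rewrite -e -e'.
  have [] := minb b' _ (esym sb); first by rewrite SS'.
    have [||lt' lt|[-> _]] := minb' b; rewrite -?SS' ?ltnn //.
    by have := ltn_trans lt lt'; rewrite ltnn.
  case=> s r; have [||lt|[_ r']] := minb' b; rewrite -?SS' //.
    by rewrite s ltnn in lt.
  by apply: antout; rewrite r r'.
Qed.

(** The optimality conditions quantify universally over edges, so they survive the removal of other
    edges. Thus the pair chosen at a node is also chosen among the edges of positive weight,
    provided that it belongs to them. *)
Lemma order_O_sub H S a b : {subset S <= H} -> a \in S -> b \in S ->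
  order_O rin rout H a b -> order_O rin rout S a b.
Proof.
move=> sSH aS bS [[_ _ e] minv mina minb]; split=> //.
- by move=> a' b' [/sSH a'H /sSH b'H e']; apply: (minv a' b').
- by move=> a' /sSH; exact: mina.
- by move=> b' /sSH; exact: minb.
Qed.

(* The greedy reduction: it depends only on the weight function, not on the
   node of the tree that carries it. *)
Inductive greedy x y : Prop :=
| greedy_stop S of (forall h, (h \in S) = (0 < x h)) &
    (forall a b, ~ reducible_pair S a b) & x = y
| greedy_step S a b of (forall h, (h \in S) = (0 < x h)) &
    order_O rin rout S a b & greedy (push a b x) y.

(** The positive support is determined by [x]; it decides whether to stop and on which pair to
    reduce. *)
Lemma greedy_unique x y y' : greedy x y -> greedy x y' -> y = y'.
Proof.
move=> g; elim: g y' => {x y} [x y S SE nS xy|x y S a b SE ab _ IH] y' [].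
- by move=> S' _ _ <-.
- move=> S' a b S'E [[aS bS e] _ _ _] _; case: (nS a b).
  by split; rewrite // SE -S'E.
- move=> S' S'E nS' _; case: (nS' a b); case: ab => -[aS bS e] _ _ _.
  by split; rewrite // S'E -SE.
- move=> S' a' b' S'E ab' gy'; apply: IH.
  have SS' : S =i S' by move=> h; rewrite SE S'E.
  by have [-> ->] := order_O_unique SS' ab ab'.
Qed.

Lemma weights_support H x : weights x H ->
  exists S, (forall h, (h \in S) = (0 < x h)) /\ {subset S <= H}.
Proof.
move=> [x0 sx]; exists [seq h <- H | 0 < x h]; split=> h; rewrite mem_filter.
  case: (boolP (h \in H)) => [_|/sx ->]; first by rewrite andbT.
  by rewrite andbF ltxx.
by case/andP.
Qed.

(** When [a + b] has weight zero, [unpush] changes nothing and the greedy reduction does not see the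
    step. Otherwise [a] and [b] have positive lifted weight, the order selects them on the support,
    and [push] restores [x]. *)
Lemma lift_weights H H'' a b x : good_node H -> order_O rin rout H a b ->
    uniq H'' -> {subset H'' <= H} -> a \notin H'' \/ b \notin H'' ->
    weights x (add_sedge a b :: H'') ->
  [/\ weights (unpush a b x) H,
      forall v, additive_on_paths v ->
        \sum_(h <- H) unpush a b x h * v h =
        \sum_(h <- add_sedge a b :: H'') x h * v h
    & forall y, greedy x y -> greedy (unpush a b x) y].
Proof.
move=> gH ord uH'' sH nH wx; have [redab _ _ _] := ord; have [x0 sx] := wx.
have [nab na nb] := add_sedge_neq gH redab.
have w : weights (unpush a b x) H.
  by split; [exact: (unpush_ge0 gH redab)|exact: (unpush_supported redab sH)].
split=> //.
  by move=> v av; apply: (unpush_sum gH redab) => //; apply: av; case: redab.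
have xab : x a = 0 \/ x b = 0.
  by case: nH => ?; [left|right]; apply: sx; rewrite inE eq_sym ?na ?nb.
move=> y gy; have := x0 (add_sedge a b); rewrite le_eqVlt => /orP [/eqP z|pos].
  suff -> : unpush a b x = x by [].
  by apply/funext => h; rewrite /unpush -z !mul0r !addr0 subr0.
have [S [SE sS]] := weights_support w.
have pa : 0 < unpush a b x a.
  rewrite /unpush eqxx nab eq_sym na !mulr0 mulr1 addr0 subr0.
  by rewrite (lt_le_trans pos) // lerDr.
have pb : 0 < unpush a b x b.
  rewrite /unpush eqxx eq_sym nab eq_sym nb !mulr0 mulr1 addr0 subr0.
  by rewrite (lt_le_trans pos) // lerDr.
apply: (greedy_step SE); first by apply: order_O_sub ord; rewrite // SE.
by rewrite (pushK gH redab).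
Qed.

Lemma leaf_irreducible T L : reductions_follow (order_O rin rout) T ->
  L \in leaves T -> forall a b, ~ reducible_pair L a b.
Proof.
elim: T => /= [H red|H Tl IHl Tm IHm Tr IHr [_ [fl fm fr]]].
  by rewrite inE => /eqP ->.
by rewrite !mem_cat => /or3P []; [exact: IHl|exact: IHm|exact: IHr].
Qed.

Lemma leaf_good T L : reductions_follow (order_O rin rout) T ->
  good_node (Defs.root T) -> L \in leaves T -> good_node L.
Proof.
elim: T => /= [H _ gH|
  H Tl IHl Tm IHm Tr IHr [[a [b [red _ rl rm rr]]] [fl fm fr]] gH].
  by rewrite inE => /eqP ->.
rewrite !mem_cat => /or3P [].
- by apply: IHl => //; rewrite rl; exact: reduce1_good.
- by apply: IHm => //; rewrite rm; exact: reduce3_good.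
- by apply: IHr => //; rewrite rr; exact: reduce2_good.
Qed.

Lemma leaf_lift T L y : reductions_follow (order_O rin rout) T ->
    good_node (Defs.root T) -> L \in leaves T -> weights y L ->
  exists x, [/\ weights x (Defs.root T),
    forall v, additive_on_paths v ->
      \sum_(h <- Defs.root T) x h * v h = \sum_(h <- L) y h * v h
    & greedy x y].
Proof.
elim: T => /= [H red gH|
  H Tl IHl Tm IHm Tr IHr [[a [b [red ord rl rm rr]]] [fl fm fr]] gH].
  rewrite inE => /eqP -> wy; exists y; split=> //.
  (* The support of a weight on an irreducible graph is irreducible, so the greedy reduction stops
     at once. *)
  have [S [SE sS]] := weights_support wy.
  apply: (greedy_stop SE) => // a b [aS bS e]; apply: (red a b).
  by split=> //; exact: sS.
have uH := good_uniq gH.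
have lift H'' : uniq H'' -> {subset H'' <= H} -> a \notin H'' \/ b \notin H'' ->
    (exists x, [/\ weights x (add_sedge a b :: H''),
      forall v, additive_on_paths v ->
        \sum_(h <- add_sedge a b :: H'') x h * v h = \sum_(h <- L) y h * v h
      & greedy x y]) ->
    exists x, [/\ weights x H,
      forall v, additive_on_paths v ->
        \sum_(h <- H) x h * v h = \sum_(h <- L) y h * v h
      & greedy x y].
  move=> uH'' sH nH [x [wx sx gx]].
  have [w s g] := lift_weights gH ord uH'' sH nH wx.
  by exists (unpush a b x); split=> // [v av|]; [rewrite s // sx|exact: g].
rewrite !mem_cat => /or3P [LT|LT|LT] wy.
- apply: (lift (rem b H)); rewrite ?rem_uniq //; first by move=> h /mem_rem.
    by right; rewrite mem_rem_uniq // inE eqxx.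
  by have := IHl fl; rewrite rl; apply=> //; exact: reduce1_good.
- apply: (lift (rem a (rem b H))); rewrite ?rem_uniq //.
      by move=> h /mem_rem /mem_rem.
    by left; rewrite mem_rem_uniq ?rem_uniq // inE eqxx.
  by have := IHm fm; rewrite rm; apply=> //; exact: reduce3_good.
- apply: (lift (rem a H)); rewrite ?rem_uniq //; first by move=> h /mem_rem.
    by left; rewrite mem_rem_uniq // inE eqxx.
  by have := IHr fr; rewrite rr; apply=> //; exact: reduce2_good.
Qed.

(** Both weights lift to the root, where independence of the multiplicity vectors makes the lifts
    equal; the greedy reduction brings the common lift back to a single result. *)
Lemma leaf_weights_unique T L1 L2 y1 y2 :
    reductions_follow (order_O rin rout) T -> good_node (Defs.root T) ->
    L1 \in leaves T -> L2 \in leaves T -> weights y1 L1 -> weights y2 L2 ->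
    (forall e, \sum_(h <- L1) y1 h * multiplicity e h =
               \sum_(h <- L2) y2 h * multiplicity e h) ->
  y1 = y2.
Proof.
move=> fT gT L1T L2T w1 w2 s12.
have [x1 [[_ sx1] s1 g1]] := leaf_lift fT gT L1T w1.
have [x2 [[_ sx2] s2 g2]] := leaf_lift fT gT L2T w2.
suff x12 : x1 = x2 by apply: greedy_unique g1 _; rewrite x12.
apply/funext => h; apply/eqP; rewrite -subr_eq0; apply/eqP.
apply: (good_free gT (x := fun h => x1 h - x2 h)) => [k kT|e].
  by rewrite sx1 ?sx2 ?subrr.
under eq_bigr do rewrite mulrBl.
have av := multiplicity_additive e.
by rewrite sumrB s1 // s2 // s12 subrr.
Qed.

(** Weights are pushed to the left or the right child, never to the middle one, so the number of
    edges does not drop. *)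
Lemma full_leaf_exists T x : reductions_follow (order_O rin rout) T ->
    good_node (Defs.root T) -> weights x (Defs.root T) ->
  exists L y, [/\ L \in leaves T, size L = size (Defs.root T), weights y L
    & forall v, additive_on_paths v ->
        \sum_(h <- L) y h * v h = \sum_(h <- Defs.root T) x h * v h].
Proof.
elim: T x => /= [H|H Tl IHl Tm _ Tr IHr] x.
  by move=> _ _ wx; exists H, x; rewrite mem_head.
move=> [[a [b [red ord rl rm rr]]] [fl fm fr]] gH [x0 sx].
have uH := good_uniq gH; have [nab na nb] := add_sedge_neq gH red.
have [aH bH e] := red.
have szH h : h \in H -> (size (rem h H)).+1 = size H.
  by move=> hH; rewrite size_rem // prednK //; case: (H) hH.
have p0 h : 0 <= push a b x h.
  have m0 : 0 <= Num.min (x a) (x b) by rewrite le_min !x0.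
  rewrite /push; case: (eqVneq h a) => [->|_].
    by rewrite nab eq_sym na !mulr0 mulr1 subr0 addr0 subr_ge0 ge_min lexx.
  case: (eqVneq h b) => [->|_].
    by rewrite eq_sym nb !mulr0 mulr1 subr0 addr0 subr_ge0 ge_min lexx orbT.
  by rewrite !mulr0 !subr0 addr_ge0 // mulr_ge0.
have step H'' : (forall h, h \in H -> h \notin H'' -> push a b x h = 0) ->
    weights (push a b x) (add_sedge a b :: H'').
  move=> pH; split=> // h; rewrite inE negb_or => /andP [hab hH''].
  case: (boolP (h \in H)) => [/pH -> //|hH].
  have F c : c \in H -> (h == c) = false.
    by move=> cH; apply: contraNF hH => /eqP ->.
  by rewrite /push (F a aH) (F b bH) (negPf hab) !mulr0 !subr0 addr0 sx.
have sums H'' : uniq H'' -> {subset H'' <= H} ->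
    weights (push a b x) (add_sedge a b :: H'') ->
    forall v, additive_on_paths v ->
      \sum_(h <- add_sedge a b :: H'') push a b x h * v h = \sum_(h <- H) x h * v h.
  move=> uH'' sH [_ sp] v av.
  by rewrite -(unpush_sum gH red (av _ _ e) uH'' sH sp) (unpushK gH red).
(* The lighter of [a] and [b] is emptied by [push]; the left child omits [b] and the right child
   omits [a]. *)
have [xba|xab] := leP (x b) (x a).
- have wp : weights (push a b x) (reduce1 H a b).
    apply: step => h hH; rewrite mem_rem_uniq // inE hH andbT negbK => /eqP ->.
    rewrite /push (min_idPr xba) eqxx eq_sym nab eq_sym nb !mulr0 mulr1.
    by rewrite subr0 addr0 subrr.
  have [||L [y [LT sL wy sy]]] := IHl (push a b x) fl; rewrite ?rl //.
    exact: reduce1_good.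
  exists L, y; split=> //; first by rewrite mem_cat LT.
    by rewrite sL rl /= szH.
  move=> v av; rewrite sy // rl; apply: sums => //; first exact: rem_uniq.
  by move=> h /mem_rem.
- have wp : weights (push a b x) (reduce2 H a b).
    apply: step => h hH; rewrite mem_rem_uniq // inE hH andbT negbK => /eqP ->.
    rewrite /push (min_idPl (ltW xab)) eqxx nab eq_sym na !mulr0 mulr1.
    by rewrite subr0 addr0 subrr.
  have [||L [y [LT sL wy sy]]] := IHr (push a b x) fr; rewrite ?rr //.
    exact: reduce2_good.
  exists L, y; split=> //; first by rewrite !mem_cat LT !orbT.
    by rewrite sL rr /= szH.
  move=> v av; rewrite sy // rr; apply: sums => //; first exact: rem_uniq.
  by move=> h /mem_rem.
Qed.

(** Weight 1 on every edge of [L] lifts to the root and is pushed to a full dimensional leaf [L'].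
    By uniqueness the result is the same function, so every edge of [L] lies in [L']. *)
Lemma leaf_sub_full T L : reductions_follow (order_O rin rout) T ->
    good_node (Defs.root T) -> L \in leaves T ->
  exists L', [/\ L' \in leaves T, size L' = size (Defs.root T) & {subset L <= L'}].
Proof.
move=> fT gT LT; pose y h : R := (h \in L)%:R.
have wy : weights y L by split=> [h|h /negPf hL]; rewrite /y ?ler0n ?hL.
have [x [wx sx _]] := leaf_lift fT gT LT wy.
have [L' [y' [L'T sL' wy' sy']]] := full_leaf_exists fT gT wx.
exists L'; split=> // h hL; apply: contraT => /(proj2 wy').
rewrite -(leaf_weights_unique fT gT LT L'T wy wy').
  by rewrite /y hL => /eqP; rewrite oner_eq0.
have av := multiplicity_additive.
by move=> e; rewrite -sx // sy'.
Qed.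

End Reduction.

(** * Flows on the augmented graph *)

Section Flow.
Variables (R : realType) (n : nat) (G : mgraph n).
Implicit Types (L : sgraph G) (h : sedge G) (i : 'I_n).

Local Notation flows := {ffun edges (augment G) -> R^o}.

(** At the root the multiplicity vectors are the standard basis. *)
Lemma good_initial : good_node R (initial_sgraph G).
Proof.
have inj : injective (fun e : edges G => (esrc e, etgt e, [:: e]) : sedge G).
  by move=> e e' [].
have multE e e' : multiplicity R e (esrc e', etgt e', [:: e']) = (e' == e)%:R.
  by rewrite /multiplicity /= addn0.
split.
- by rewrite map_inj_uniq ?enum_uniq.
- by move=> h /mapP [e _ ->]; exact: esrc_lt_etgt.
- move=> h /mapP [e _ ->] i; rewrite (bigD1 e) //= multE eqxx mul1r big1 ?addr0 //.
  by move=> e' /negPf ne; rewrite multE eq_sym ne mul0r.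
- move=> x sx x0 h; case: (boolP (h \in initial_sgraph G)) => [|/sx //].
  case/mapP=> e _ ->; have := x0 e.
  rewrite big_map big_enum (bigD1 e) //= multE eqxx mulr1 big1 ?addr0 //.
  by move=> e' /negPf ne; rewrite multE ne mulr0.
Qed.

Definition flow_of h : flows := unit_flow R (route (ssrc h) (stgt h) (summands h)).

Lemma flow_of_edge h (e : edges G) :
  flow_of h (inl e : edges (augment G)) = multiplicity R e h.
Proof.
rewrite ffunE /= -cats1 count_cat /= addn0 add0n /multiplicity; congr (_%:R).
by rewrite addn0 count_map; apply: eq_count => e' /=.
Qed.

Lemma flow_of_source h i :
  flow_of h (inr (inl i) : edges (augment G)) = (ssrc h == i)%:R.
Proof.
rewrite ffunE /= -cats1 count_cat /= addn0 addn0 count_map.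
by rewrite (eq_count (a2 := pred0)) // count_pred0 addn0.
Qed.

Lemma flow_of_sink h i :
  flow_of h (inr (inr i) : edges (augment G)) = (stgt h == i)%:R.
Proof.
rewrite ffunE /= -cats1 count_cat /= addn0 add0n count_map.
by rewrite (eq_count (a2 := pred0)) // count_pred0.
Qed.

Lemma inner_vertex_inj : injective (@inner_vertex n).
Proof. by move=> i j /lift_inj /lift_inj. Qed.

Lemma inner_vertexP (v : 'I_n.+2) : v != ord0 -> v != ord_max ->
  exists i, v = inner_vertex i.
Proof.
move=> v0 vm; have lt : (v.-1 < n)%N.
  have := ltn_ord v; rewrite -!val_eqE /= in v0 vm.
  by case: (val v) v0 vm => //= m _; rewrite eqSS !ltnS leq_eqVlt => /negPf ->.
by exists (Ordinal lt); apply: ord_inj; rewrite inner_vertexE /= prednK // lt0n.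
Qed.

(** Only the edges [(s, i)] leave [s] and only the edges [(i, t)] enter [t], so the conditions
    separate by kind of edge. *)
Lemma flow_polytopeP (f : flows) : flow_polytope R (augment G) f <->
  [/\ forall x, 0 <= f x,
      \sum_i f (inr (inl i)) = 1, \sum_i f (inr (inr i)) = 1
    & forall i, f (inr (inl i)) +
        \sum_e f (inl e) * ((etgt e == i)%:R - (esrc e == i)%:R) = f (inr (inr i))].
Proof.
have i0 i : (inner_vertex i == ord0) = false by [].
have im i : (inner_vertex i == ord_max) = false.
  by apply/eqP => /(congr1 (@nat_of_ord _)) /eqP; rewrite inner_vertexE eqSS ltn_eqF.
have ii i j : (inner_vertex i == inner_vertex j) = (i == j).
  exact: (inj_eq inner_vertex_inj).
have srcE v : \sum_(x : edges (augment G) | esrc x == v) f x =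
    \sum_(e | inner_vertex (esrc e) == v) f (inl e) +
    (\sum_(i | ord0 == v) f (inr (inl i)) +
     \sum_(i | inner_vertex i == v) f (inr (inr i))).
  by rewrite big_sumType /= big_sumType.
have tgtE v : \sum_(x : edges (augment G) | etgt x == v) f x =
    \sum_(e | inner_vertex (etgt e) == v) f (inl e) +
    (\sum_(i | inner_vertex i == v) f (inr (inl i)) +
     \sum_(i | ord_max == v) f (inr (inr i))).
  by rewrite big_sumType /= big_sumType.
have srcs : \sum_(x : edges (augment G) | esrc x == ord0) f x =
    \sum_i f (inr (inl i)).
  rewrite srcE eqxx [X in X + _]big_pred0 // [X in _ + (_ + X)]big_pred0 //.
  by rewrite add0r addr0.
have tgtt : \sum_(x : edges (augment G) | etgt x == ord_max) f x =
    \sum_i f (inr (inr i)).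
  rewrite tgtE eqxx [X in X + _]big_pred0 // [X in _ + (X + _)]big_pred0 //.
  by rewrite !add0r.
have cons i : (\sum_(x : edges (augment G) | etgt x == inner_vertex i) f x =
    \sum_(x : edges (augment G) | esrc x == inner_vertex i) f x) <->
    f (inr (inl i)) + \sum_e f (inl e) * ((etgt e == i)%:R - (esrc e == i)%:R)
      = f (inr (inr i)).
  rewrite srcE tgtE.
  rewrite [X in _ + (X + _)](big_pred1 i) => [|j]; last exact: ii.
  rewrite [X in _ + (_ + X)]big_pred0 => [|j]; last by rewrite eq_sym im.
  rewrite [X in _ = _ + (X + _)]big_pred0 => [|j]; last by rewrite eq_sym i0.
  rewrite [X in _ = _ + (_ + X)](big_pred1 i) => [|j]; last exact: ii.
  have -> : \sum_e f (inl e) * ((etgt e == i)%:R - (esrc e == i)%:R) =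
      \sum_(e | inner_vertex (etgt e) == inner_vertex i) f (inl e) -
      \sum_(e | inner_vertex (esrc e) == inner_vertex i) f (inl e).
    rewrite [X in X - _]big_mkcond [X in _ - X]big_mkcond -sumrB.
    apply: eq_bigr => e _; rewrite !ii mulrBr.
    by case: eqP => _; case: eqP => _; rewrite ?mulr1 ?mulr0.
  by split=> E; lra.
split=> [[f0 fs ft fc]|[f0 fs ft fc]]; split=> //.
- by rewrite -srcs.
- by rewrite -tgtt.
- by move=> i; apply/cons/fc; rewrite ?i0 ?im.
- by rewrite srcs.
- by rewrite tgtt.
- by move=> v v0 vm; have [i ->] := inner_vertexP v0 vm; apply/cons/fc.
Qed.

(** Stands for the route [(s, i)], [(i, t)]. As a loop in [sedge G] it shares an index type with the
    edges of a leaf, yet lies in no good node. *)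
Definition empty_path i : sedge G := (i, i, [::]).

Definition leaf_routes L : sgraph G := [seq empty_path i | i <- enum 'I_n] ++ L.

(** In an irreducible graph a walk uses at most one edge. *)
Lemma node_polytopeE L : (forall a b, ~ reducible_pair L a b) ->
  node_polytope R L = hull flow_of (leaf_routes L).
Proof.
move=> irrL; congr convex_hull; apply/seteqP; split=> f.
- case=> v [w [p [/(walk_leaf _ _ _ irrL) vwp ->]]]; exists (v, w, p) => //=.
  rewrite mem_cat; case: vwp => [[<- ->]|->]; last by rewrite orbT.
  by rewrite (map_f empty_path) ?mem_enum.
- case=> -[[v w] p] /= + <-; rewrite mem_cat => vwp.
  exists v, w, p; split=> //; apply/(walk_leaf _ _ _ irrL).
  by case/orP: vwp => [/mapP [i _ [-> -> ->]]|]; [left|right].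
Qed.

Lemma empty_path_inj : injective empty_path.
Proof. by move=> i j []. Qed.

Lemma empty_path_notin L i : good_node R L -> empty_path i \notin L.
Proof. by move=> gL; apply/negP => /(good_lt gL); rewrite ltnn. Qed.

Lemma leaf_routes_uniq L : good_node R L -> uniq (leaf_routes L).
Proof.
move=> gL; rewrite cat_uniq (map_inj_uniq empty_path_inj) enum_uniq (good_uniq gL).
rewrite andbT /=; apply/hasPn => h hL; apply/negP => /mapP [i _ e].
by move: (empty_path_notin i gL); rewrite -e hL.
Qed.

Lemma sum_leaf_routes (y v : sedge G -> R) L :
  \sum_(h <- leaf_routes L) y h * v h =
  \sum_i y (empty_path i) * v (empty_path i) + \sum_(h <- L) y h * v h.
Proof. by rewrite big_cat big_map big_enum. Qed.

Lemma sum_flowE (y : sedge G -> R) L (x : edges (augment G)) :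
  (\sum_(h <- L) y h *: flow_of h) x = \sum_(h <- L) y h * flow_of h x.
Proof. by rewrite sum_ffunE; apply: eq_bigr => h _; rewrite ffunE. Qed.

Lemma sum_flow_edge (y : sedge G -> R) L (e : edges G) :
  (\sum_(h <- leaf_routes L) y h *: flow_of h) (inl e : edges (augment G)) =
  \sum_(h <- L) y h * multiplicity R e h.
Proof.
rewrite sum_flowE sum_leaf_routes big1 ?add0r => [|i _].
  by apply: eq_bigr => h _; rewrite flow_of_edge.
by rewrite flow_of_edge mulr0.
Qed.

Lemma sum_flow_source (y : sedge G -> R) L i :
  (\sum_(h <- leaf_routes L) y h *: flow_of h) (inr (inl i) : edges (augment G)) =
  y (empty_path i) + \sum_(h <- L) y h * (ssrc h == i)%:R.
Proof.
rewrite sum_flowE sum_leaf_routes (bigD1 i) //= big1 ?addr0 => [|j /negPf ji].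
  rewrite flow_of_source eqxx mulr1; congr (_ + _).
  by apply: eq_bigr => h _; rewrite flow_of_source.
by rewrite flow_of_source -[ssrc (empty_path j)]/j ji mulr0.
Qed.

Lemma sum_flow_sink (y : sedge G -> R) L i :
  (\sum_(h <- leaf_routes L) y h *: flow_of h) (inr (inr i) : edges (augment G)) =
  y (empty_path i) + \sum_(h <- L) y h * (stgt h == i)%:R.
Proof.
rewrite sum_flowE sum_leaf_routes (bigD1 i) //= big1 ?addr0 => [|j /negPf ji].
  rewrite flow_of_sink eqxx mulr1; congr (_ + _).
  by apply: eq_bigr => h _; rewrite flow_of_sink.
by rewrite flow_of_sink -[stgt (empty_path j)]/j ji mulr0.
Qed.

Lemma flow_of_in_polytope h : is_path R h -> flow_polytope R (augment G) (flow_of h).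
Proof.
move=> ph; apply/flow_polytopeP; split.
- by move=> x; rewrite ffunE ler0n.
- under eq_bigr do rewrite flow_of_source.
  rewrite (bigD1 (ssrc h)) //= eqxx big1 ?addr0 // => i /negPf ni.
  by rewrite eq_sym ni.
- under eq_bigr do rewrite flow_of_sink.
  rewrite (bigD1 (stgt h)) //= eqxx big1 ?addr0 // => i /negPf ni.
  by rewrite eq_sym ni.
- move=> i; under eq_bigr do rewrite flow_of_edge.
  by rewrite flow_of_source flow_of_sink ph /net addrC subrK.
Qed.

Lemma hull_sub_flow_polytope L : good_node R L ->
  hull flow_of (leaf_routes L) `<=` flow_polytope R (augment G).
Proof.
move=> gL; apply: smallest_sub; last first.
  move=> _ [h + <-]; rewrite /= mem_cat => /orP [/mapP [i _ ->]|hL].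
    apply: flow_of_in_polytope => j; rewrite big1 => [|e _]; last by rewrite mul0r.
    by rewrite /net subrr.
  by apply: flow_of_in_polytope; exact: (good_path gL).
apply: convex_setI => f g t t0 t1 /flow_polytopeP [f0 fs ft fc]
  /flow_polytopeP [g0 gs gt gc]; apply/flow_polytopeP.
have E x : (t *: f + (1 - t) *: g) x = t * f x + (1 - t) * g x by rewrite !ffunE.
split.
- by move=> x; rewrite E addr_ge0 // mulr_ge0 // subr_ge0.
- under eq_bigr do rewrite E.
  by rewrite big_split /= -!mulr_sumr fs gs !mulr1 addrC subrK.
- under eq_bigr do rewrite E.
  by rewrite big_split /= -!mulr_sumr ft gt !mulr1 addrC subrK.
- move=> i; rewrite !E -fc -gc.
  under eq_bigr do rewrite E mulrDl -!mulrA.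
  rewrite big_split /= -!mulr_sumr; ring.
Qed.

Variables (rin rout : rel (sedge G)) (T : rtree G).
Hypotheses (linin : is_linear_order rin) (linout : is_linear_order rout).
Hypothesis TO : is_reduction_tree_O rin rout T.

Let good_root : good_node R (Defs.root T).
Proof. by case: TO => -> _; exact: good_initial. Qed.

(** Coordinates on edges of [G] do not see the empty paths, so [leaf_weights_unique] settles the
    weights on the leaf edges; the source coordinates then give those of the empty paths. *)
Lemma leaf_routes_unique :
  unique_weights flow_of [set leaf_routes L | L in [set L | L \in leaves T]].
Proof.
have [_ fT] := TO.
move=> _ _ y1 y2 [L1 L1T <-] [L2 L2T <-] [y10 s1] [y20 s2] s12.
have gL1 := leaf_good fT good_root L1T; have gL2 := leaf_good fT good_root L2T.
pose z L (y : sedge G -> R) h := if h \in L then y h else 0.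
have wz L (y : sedge G -> R) : (forall h, 0 <= y h) -> weights (z L y) L.
  by move=> y0; split=> h; rewrite /z; [case: ifP|move=> /negPf ->].
have sz L (y v : sedge G -> R) :
    \sum_(h <- L) z L y h * v h = \sum_(h <- L) y h * v h.
  by apply: eq_big_seq => h hL; rewrite /z hL.
have z12 : z L1 y1 = z L2 y2.
  apply: (leaf_weights_unique linin linout fT good_root L1T L2T);
    [exact: wz|exact: wz|move=> e].
  by rewrite !sz -!sum_flow_edge s12.
have ye i : y1 (empty_path i) = y2 (empty_path i).
  have := congr1 (fun f : flows => f (inr (inl i))) s12.
  rewrite !sum_flow_source -(sz L1) -(sz L2) z12.
  (* [z L2 y2] is supported on both [L1] and [L2], so both sums reduce to the common edges. *)
  suff -> : \sum_(h <- L1) z L2 y2 h * (ssrc h == i)%:R =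
            \sum_(h <- L2) z L2 y2 h * (ssrc h == i)%:R by apply: addIr.
  have sub (L L' : sgraph G) : uniq L -> uniq L' -> supported (z L2 y2) L ->
      supported (z L2 y2) L' -> \sum_(h <- L) z L2 y2 h * (ssrc h == i)%:R =
      \sum_(h <- [seq h <- L | h \in L']) z L2 y2 h * (ssrc h == i)%:R.
    move=> uL uL' sL sL'; apply: sum_supportedM; rewrite ?filter_uniq //.
      exact: supportedI.
    exact/mem_subseq/filter_subseq.
  have u1 := good_uniq gL1; have u2 := good_uniq gL2.
  have [_ sp2] := wz L2 _ y20; have [_ sp1] := wz L1 _ y10; rewrite z12 in sp1.
  rewrite (sub L1 L2) // (sub L2 L1) //; apply: perm_big.
  apply: uniq_perm; rewrite ?filter_uniq // => h.
  by rewrite !mem_filter andbC.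
move=> h; have zh := congr1 (@^~ h) z12; rewrite /z in zh.
case: (boolP (h \in [seq empty_path i | i <- enum 'I_n])) => [/mapP [i _ ->] //|he].
have F (L : sgraph G) (y : sedge G -> R) : supported y (leaf_routes L) ->
    (if h \in L then y h else 0) = y h.
  move=> sy; case: (boolP (h \in L)) => // hL.
  by rewrite sy // mem_cat negb_or he.
by rewrite -(F L1 y1) // -(F L2 y2).
Qed.

(** The part of [f] on edges of [G] is a weight on the root, which is pushed to a full dimensional
    leaf [L]. What remains on [(s, i)] is carried by the empty path at [i]. *)
Lemma flow_polytope_cover (f : flows) : flow_polytope R (augment G) f ->
  exists2 L, is_full_dim_leaf T L & hull flow_of (leaf_routes L) f.
Proof.
have [rT fT] := TO.
case/flow_polytopeP => f0 fs ft fc.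
pose E (e : edges G) : sedge G := (esrc e, etgt e, [:: e]).
have Einj : injective E by move=> e e' [].
pose x h : R := \sum_(e | E e == h) f (inl e).
have wx : weights x (Defs.root T).
  split=> [h|h hT]; first exact: sumr_ge0.
  rewrite /x big_pred0 // => e; apply: contraNF hT => /eqP <-.
  by rewrite rT (map_f E) ?mem_enum.
have xE e : x (E e) = f (inl e).
  by rewrite /x (big_pred1 e) // => e'; exact: (inj_eq Einj).
have [L [y [LT sL [y0 sy] yE]]] := full_leaf_exists fT good_root wx.
have gL := leaf_good fT good_root LT; have irrL := leaf_irreducible fT LT.
have rootE v : additive_on_paths v ->
    \sum_(h <- L) y h * v h = \sum_e f (inl e) * v (E e).
  move=> av; rewrite yE // rT /initial_sgraph big_map big_enum.
  by apply: eq_bigr => e _; rewrite -/(E e) xE.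
pose r i := f (inr (inl i)) - \sum_(h <- L) y h * (ssrc h == i)%:R.
(* By conservation the remainders on [(s, i)] and [(i, t)] agree, since the weighted sum of [net] is
   the same on [L] as at the root. *)
have rE i : r i = f (inr (inr i)) - \sum_(h <- L) y h * (stgt h == i)%:R.
  rewrite -fc /r -(rootE (@net R n G i)); last exact: net_additive.
  by under [in RHS]eq_bigr do rewrite /net mulrBr; rewrite sumrB; ring.
(* In an irreducible leaf no vertex has edges both entering and leaving it, so one of the two
   expressions of [r i] is a mere coordinate of [f]. *)
have r0 i : 0 <= r i.
  case: (boolP (has (fun h => ssrc h == i) L)) => [/hasP [b bL /eqP bi]|/hasPn ns].
    rewrite rE big_seq big1 ?subr0 // => a aL.
    case: eqP => [ai|_]; last by rewrite mulr0.
    by case: (irrL a b); split; rewrite // ai bi.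
  by rewrite /r big_seq big1 ?subr0 // => h /ns /negPf ->; rewrite mulr0.
pose z h : R := y h + \sum_(i | empty_path i == h) r i.
have zL h : h \in L -> z h = y h.
  move=> hL; rewrite /z big_pred0 ?addr0 // => i; apply/negP => /eqP e.
  by move: (empty_path_notin i gL); rewrite e hL.
have ze i : z (empty_path i) = r i.
  rewrite /z sy ?empty_path_notin // add0r (big_pred1 i) // => j.
  exact: (inj_eq empty_path_inj).
have sz (v : sedge G -> R) : \sum_(h <- L) z h * v h = \sum_(h <- L) y h * v h.
  by apply: eq_big_seq => h hL; rewrite zL.
exists L; first by split=> //; rewrite sL rT size_map -cardE.
apply/hullP; first exact: leaf_routes_uniq.
have fE : f = \sum_(h <- leaf_routes L) z h *: flow_of h.
  apply/ffunP => -[e|[i|i]].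
  - rewrite sum_flow_edge sz rootE; last exact: multiplicity_additive.
    rewrite (bigD1 e) //= /multiplicity /= eqxx mulr1 big1 ?addr0 // => e' /negPf ->.
    by rewrite mulr0.
  - by rewrite sum_flow_source sz ze /r subrK.
  - by rewrite sum_flow_sink sz ze rE subrK.
exists z; split=> //.
- split=> [h|h]; first by rewrite addr_ge0 // sumr_ge0.
  rewrite mem_cat negb_or => /andP [he hL]; rewrite /z sy // add0r big_pred0 // => i.
  by apply: contraNF he => /eqP <-; rewrite (map_f empty_path) ?mem_enum.
(* Every route leaves [s] once, so the total weight is the outflow at [s]. *)
- rewrite -fs [in RHS]fE.
  under [in RHS]eq_bigr do rewrite sum_flowE.
  rewrite exchange_big; apply: eq_bigr => h _ /=.
  rewrite -mulr_sumr (bigD1 (ssrc h)) //= flow_of_source eqxx big1 ?addr0 ?mulr1 //.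
  by move=> i /negPf ni; rewrite flow_of_source eq_sym ni.
Qed.

End Flow.

(** * Triangulation by the full dimensional leaves *)

Unset Implicit Arguments.

Theorem theorem2 (R : realType) (n : nat) (G : mgraph n)
    (rin rout : rel (sedge G)) (T : rtree G) :
  is_linear_order rin -> is_linear_order rout ->
  is_reduction_tree_O rin rout T ->
  let C := faces_of [set node_polytope R L | L in is_full_dim_leaf T] in
  is_triangulation (flow_polytope R (augment G)) C
  /\ forall L, is_leaf T L -> C (node_polytope R L).
Proof.
move=> linin linout TO C; have [rT fT] := TO.
have gT : good_node R (Defs.root T) by rewrite rT; exact: good_initial.
have hullE L : L \in leaves T ->
    node_polytope R L = hull (@flow_of R n G) (leaf_routes L).
  by move=> LT; apply: node_polytopeE; exact: leaf_irreducible fT LT.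
have uniqT L : L \in leaves T -> uniq (leaf_routes L).
  by move=> LT; apply: (leaf_routes_uniq (R := R)); exact: leaf_good fT gT LT.
have uT := leaf_routes_unique (R := R) linin linout TO.
pose A := [seq leaf_routes L | L <- leaves T & size L == #|edges G|].
have AP K : K \in A <-> exists2 L, is_full_dim_leaf T L & K = leaf_routes L.
  split=> [/mapP [L + ->]|[L [LT sL] ->]].
    by rewrite mem_filter => /andP [/eqP sL LT]; exists L.
  by rewrite map_f // mem_filter sL eqxx.
have CE : C = faces_of [set hull (@flow_of R n G) K | K in [set K | K \in A]].
  congr faces_of; apply/seteqP; split=> S.
    case=> L [LT sL] <-; exists (leaf_routes L); last by rewrite hullE.
    by apply/AP; exists L.
  by case=> K /AP [L [LT sL] ->] <-; exists L => //; rewrite hullE.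
split.
  rewrite CE; apply: triangulation_of_unique_weights.
  - by move=> K /AP [L [LT _] ->]; exact: uniqT.
  - move=> K1 K2 y1 y2 /AP [L1 [L1T _] ->] /AP [L2 [L2T _] ->].
    by apply: uT; [exists L1|exists L2].
  - apply/seteqP; split=> f.
      case=> K /AP [L [LT _] ->]; apply: hull_sub_flow_polytope.
      exact: leaf_good fT gT LT.
    move=> /(flow_polytope_cover TO) [L LT fL].
    by exists (leaf_routes L) => //; apply/AP; exists L.
move=> L LT; have [L' [L'T sL' LL']] := leaf_sub_full (R := R) linin linout fT gT LT.
have full : is_full_dim_leaf T L'.
  by split=> //; rewrite sL' rT size_map -cardE.
exists (node_polytope R L'); first by exists L'.
(* The routes of [L] are among those of [L']; filtering the list of [L'] presents them as a
   selection, as [hull_face] expects. *)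
have -> : node_polytope R L =
    hull (@flow_of R n G) [seq h <- leaf_routes L' | h \in leaf_routes L].
  rewrite hullE //; apply/seteqP; split; apply: hull_sub => h; rewrite mem_filter.
    move=> hL; rewrite hL; move: hL; rewrite !mem_cat.
    by case/orP=> [->//|/LL' ->]; rewrite orbT.
  by case/andP.
rewrite hullE //; apply: hull_face; first exact: uniqT.
by apply: (unique_weights_free uT); exists L'.
Qed.
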